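(* Let $n$ be a positive integer, let $x,y\in\mathbb{B}^n$ be arbitrary and let $w=\frac{|x-y|}{2}e_1$. Then $$\tilde{\tau}_{\mathbb{B}^n}(x,y)\ge\tilde{\tau}_{\mathbb{B}^n}(-w,w)=\log\left(1+\frac{2|x-y|}{\sqrt{4-|x-y|^2}}\right)\ge c\,|x-y|,$$ where $$c=\frac{1}{t_0}\log\left(1+\frac{2t_0}{\sqrt{4-t_0^2}}\right)=\min_{0<t<2}\frac1t\log\left(1+\frac{2t}{\sqrt{4-t^2}}\right)\quad(c\approx 0.76)$$ and $t_0\in(0,2)$ ($t_0\approx1.16$) is the solution in $(0,2)$ of the equation $$(4-t^2)\left(2t+\sqrt{4-t^2}\right)\log\left(1+\frac{2t}{\sqrt{4-t^2}}\right)-8t=0.$$ The first inequality becomes an equality when $y=-x$.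
   Context: $|\cdot|$ is the Euclidean norm on $\mathbb{R}^n$, $\mathbb{B}^n=\{x\in\mathbb{R}^n:|x|<1\}$, and $e_1$ is the first standard unit vector of $\mathbb{R}^n$. The scale invariant Cassinian metric of a domain $D\subsetneq\mathbb{R}^n$ is $$\tilde{\tau}_D(x,y)=\log\left(1+\sup_{p\in\partial D}\frac{|x-y|}{\sqrt{|x-p||p-y|}}\right),\quad x,y\in D.$$ *)

(* Defs.v *)
From HB Require Import structures.
From mathcomp Require Import all_boot all_order all_algebra.
From mathcomp Require Import all_classical all_reals all_analysis.

Set Implicit Arguments.
Unset Strict Implicit.
Unset Printing Implicit Defensive.

Import Order.TTheory GRing.Theory Num.Theory.
Import numFieldNormedType.Exports.

Local Open Scope classical_set_scope.
Local Open Scope ring_scope.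

(* The norm that the library puts on row vectors is the sup norm, so the
   Euclidean norm is defined here.  The two induce the same topology, hence the
   library's closure and interior are the usual ones on R^n. *)
Definition enorm (R : realType) (n : nat) (x : 'rV[R]_n) : R :=
  Num.sqrt (\sum_(i < n) x 0 i ^+ 2).

Definition unit_ball (R : realType) (n : nat) : set 'rV[R]_n :=
  [set x | enorm x < 1].

Definition boundary (T : topologicalType) (D : set T) : set T :=
  closure D `\` interior D.

(* Written for every n, so that no successor is needed in the dimension;
   for n = 0 this is the zero vector. *)
Definition e1 (R : realType) (n : nat) : 'rV[R]_n :=
  \row_(j < n) (j == 0%N :> nat)%:R.

(* When D is a proper subdomain of R^n and x, y are in D, the boundary is
   nonempty and at positive distance from x and y: the set below is then
   nonempty and bounded, and its real-valued sup is the true supremum. *)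
Definition cassinian (R : realType) (n : nat) (D : set 'rV[R]_n)
    (x y : 'rV[R]_n) : R :=
  ln (1 + sup [set enorm (x - y) / Num.sqrt (enorm (x - p) * enorm (p - y))
              | p in boundary D]).

(* Main.v *)
Require Import Defs.
From mathcomp Require Import all_boot all_order all_algebra.
From mathcomp Require Import all_classical all_reals all_analysis.
From mathcomp Require Import ring lra.
Import Order.TTheory GRing.Theory Num.Theory.
Import numFieldNormedType.Exports.
Local Open Scope classical_set_scope.
Local Open Scope ring_scope.

(**
The supremum that defines the metric of the unit ball runs over the unit
sphere ([boundary_unit_ball]), so it is governed by the smallest product
|x - p||p - y| with |p| = 1.  Put s = |x - y| / 2.  The line through x and y
meets the sphere in two points; at the one nearer to the midpoint m of x and y
the product of the distances is tau^2 - s^2, where tau is the distance from m,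
and tau^2 <= 1 - |m|^2 <= 1 ([near_endpoint]).  Hence every pair at distance
2s has a sphere point with product at most 1 - s^2 ([cassinian_ge]).  For a
pair x, -x no sphere point does better, since
(|x - p||p + x|)^2 = (1 + |x|^2)^2 - 4 (x.p)^2 >= (1 - |x|^2)^2, so there the
bound is attained ([cassinian_opp]).  Both the comparison with the pair -w, w
and its explicit value follow.

The linear lower bound is the minimisation of L(t) / t over 0 < t < 2, where
L(t) = log (1 + 2t / sqrt (4 - t^2)).  The substitution g = 2t / sqrt (4 - t^2)
(that is, t = 2 sin a and g = 2 tan a) turns L into log (1 + g), the critical
equation into the equation crit g = 0 ([crit_ratio]), where
crit g = g (4 + g^2) / (4 (1 + g)) - log (1 + g) has a rational derivative, and
4 (L(t) / t)^2 into the function profile g, whose derivative is a positive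
multiple of crit g.  The function crit is negative on (0, 1] because
log (1 + g) >= 2g / (2 + g), and it increases on [1, oo); so it has exactly one
positive zero, where profile is minimal ([profile_min]).  Rational bounds for
two logarithms place this zero between 17/12 and 10/7, which gives the
numerical values of t0 and c ([minimal_slope]).
*)

Set Implicit Arguments.
Unset Strict Implicit.
Unset Printing Implicit Defensive.

(** * Monotonicity from the sign of a derivative *)

Lemma is_derive_mvt (R : realType) (f df : R -> R) (a b : R) : a < b ->
  (forall x, a <= x <= b -> is_derive x 1 f (df x)) ->
  exists2 c, a < c < b & f b - f a = df c * (b - a).
Proof.
move=> ab fdf; have [||c] := @MVT R f df a b ab.
- by move=> x; rewrite in_itv/= => /andP[ax xb]; apply: fdf; rewrite !ltW.
- apply: derivable_within_continuous => x; rewrite in_itv/= => xab.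
  by have [] := fdf x xab.
by rewrite in_itv/=; exists c.
Qed.

Lemma is_derive_ge0_le (R : realType) (f df : R -> R) (a b : R) : a <= b ->
  (forall x, a <= x <= b -> is_derive x 1 f (df x)) ->
  (forall x, a < x < b -> 0 <= df x) -> f a <= f b.
Proof.
rewrite le_eqVlt => /predU1P[->//|ab] fdf df0.
have [c cab fE] := is_derive_mvt ab fdf.
by rewrite -subr_ge0 fE mulr_ge0 ?df0// subr_ge0 ltW.
Qed.

Lemma is_derive_gt0_lt (R : realType) (f df : R -> R) (a b : R) : a < b ->
  (forall x, a <= x <= b -> is_derive x 1 f (df x)) ->
  (forall x, a < x < b -> 0 < df x) -> f a < f b.
Proof.
move=> ab fdf df0; have [c cab fE] := is_derive_mvt ab fdf.
by rewrite -subr_gt0 fE mulr_gt0 ?df0// subr_gt0.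
Qed.

(** The rules of differentiation for functions in applied form, with the
    derivative as an ordinary real expression: the tactic below can then read
    the rule to apply off the body of the function, and [field] can work on
    the derivative that it builds. *)
Section DerivationRules.
Context {R : realType}.
Implicit Types (f g : R -> R) (x : R).

Lemma is_derive_add f g x a b : is_derive x 1 f a -> is_derive x 1 g b ->
  is_derive x 1 (fun y => f y + g y) (a + b).
Proof. by move=> fa gb; exact: is_deriveD. Qed.

Lemma is_derive_opp f x a : is_derive x 1 f a ->
  is_derive x 1 (fun y => - f y) (- a).
Proof. by move=> fa; exact: is_deriveN. Qed.

Lemma is_derive_mul f g x a b : is_derive x 1 f a -> is_derive x 1 g b ->
  is_derive x 1 (fun y => f y * g y) (f x * b + g x * a).
Proof. by move=> fa gb; exact: is_deriveM. Qed.

Lemma is_derive_inv f x a : f x != 0 -> is_derive x 1 f a ->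
  is_derive x 1 (fun y => (f y)^-1) (- a / f x ^+ 2).
Proof.
move=> fx fa; apply: (is_derive_eq (is_deriveV fx fa) _).
by rewrite /GRing.scale/= mulNr [RHS]mulNr mulrC.
Qed.

Lemma is_derive_sqr f x a : is_derive x 1 f a ->
  is_derive x 1 (fun y => f y ^+ 2) (2 * f x * a).
Proof.
by move=> fa; apply: (is_derive_eq (is_derive_mul fa fa)); ring.
Qed.

Lemma is_derive_log f x a : 0 < f x -> is_derive x 1 f a ->
  is_derive x 1 (fun y => ln (f y)) (a / f x).
Proof.
move=> fx fa; apply: (is_derive_eq (is_derive1_comp (is_derive1_ln fx) fa) _).
by rewrite mulrC.
Qed.
End DerivationRules.

(** Instance resolution is kept out of the way with [notypeclasses refine]: it
    would instantiate an unknown derivative with ['D_1 f x] instead of an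
    explicit expression.  Functions such as [fun y => c + y] appear
    eta-reduced, whence the separate cases for partially applied operations. *)
Ltac deriv :=
  lazymatch goal with
  | |- is_derive _ _ (fun y => y) _ => exact: is_derive_id
  | |- is_derive _ _ (fun y => _ + _) _ =>
      (notypeclasses refine (is_derive_add _ _)); deriv
  | |- is_derive _ _ (fun y => - _) _ =>
      (notypeclasses refine (is_derive_opp _)); deriv
  | |- is_derive _ _ (fun y => _ ^+ 2) _ =>
      (notypeclasses refine (is_derive_sqr _)); deriv
  | |- is_derive _ _ (fun y => _ * _) _ =>
      (notypeclasses refine (is_derive_mul _ _)); deriv
  | |- is_derive _ _ (fun y => _^-1) _ =>
      (notypeclasses refine (is_derive_inv _ _)); deriv
  | |- is_derive _ _ (+%R ?c) _ =>
      (notypeclasses refine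
        (@is_derive_add _ (fun=> c) (fun y => y) _ _ _ _ _)); deriv
  | |- is_derive _ _ ( *%R ?c) _ =>
      (notypeclasses refine
        (@is_derive_mul _ (fun=> c) (fun y => y) _ _ _ _ _)); deriv
  | |- is_derive _ _ (@ln _) _ => notypeclasses refine (is_derive1_ln _)
  | |- is_derive _ _ (fun y => ln _) _ =>
      (notypeclasses refine (is_derive_log _ _)); deriv
  | |- is_derive _ _ (fun y => _) _ => exact: is_derive_cst
  | |- _ => idtac
  end.

(** * Rational bounds for the logarithm *)

(** Both sides vanish at 1, and the derivative of the difference is
    (z - 1)^2 / (z (z + 1)^2). *)
Lemma ln_ge_pade (R : realType) (z : R) : 1 <= z ->
  2 * (z - 1) / (z + 1) <= ln z.
Proof.
move=> z1.
pose f (x : R) := ln x - 2 * (x - 1) / (x + 1).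
pose df (x : R) := (x - 1) ^+ 2 / (x * (x + 1) ^+ 2).
have fz : f 1 <= f z.
  apply: (@is_derive_ge0_le _ f df _ _ z1) => x /andP[x1 xz].
    have x0 : 0 < x by lra.
    have xp : x + 1 != 0 by rewrite gt_eqF//; lra.
    rewrite /f; notypeclasses refine (is_derive_eq _ _); first by deriv.
    rewrite /df /=; field; by rewrite xp gt_eqF.
  by rewrite /df divr_ge0// ?sqr_ge0// mulr_ge0 ?sqr_ge0; lra.
by move: fz; rewrite /f ln1 subrr mulr0 mul0r subrr subr_ge0.
Qed.

(** Both sides vanish at 1, and the derivative of the difference is
    (z - 1)^3 / (z (2z + 1)^2). *)
Lemma ln_le_pade (R : realType) (z : R) : 1 <= z ->
  ln z <= (z - 1) * (z + 5) / (4 * z + 2).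
Proof.
move=> z1.
pose f (x : R) := (x - 1) * (x + 5) / (4 * x + 2) - ln x.
pose df (x : R) := (x - 1) ^+ 3 / (x * (2 * x + 1) ^+ 2).
have fz : f 1 <= f z.
  apply: (@is_derive_ge0_le _ f df _ _ z1) => x /andP[x1 xz].
    have x0 : 0 < x by lra.
    have xp : 4 * x + 2 != 0 by rewrite gt_eqF//; lra.
    have xq : 2 * x + 1 != 0 by rewrite gt_eqF//; lra.
    rewrite /f; notypeclasses refine (is_derive_eq _ _); first by deriv.
    by rewrite /df /=; field; rewrite xp xq gt_eqF.
  by rewrite /df divr_ge0 ?exprn_ge0 ?mulr_ge0 ?sqr_ge0//; lra.
by move: fz; rewrite /f ln1 subrr !mul0r subrr subr_ge0.
Qed.

(** The Pade bound is too weak at 29/12 itself; it is applied to a rational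
    number r slightly below the eighth root of 29/12, and multiplied by 8. *)
Lemma ln_29_12_ge (R : realType) : 96 / 109 <= ln (1 + 17 / 12 : R).
Proof.
pose r : R := 115 / 103.
have r1 : 1 <= r by rewrite /r; lra.
have r8 : r ^+ 8 <= 1 + 17 / 12 by rewrite /r; lra.
apply: (@le_trans _ _ (ln (r ^+ 8))).
  rewrite lnXn ?(lt_le_trans ltr01 r1)//.
  have := ln_ge_pade r1.
  rewrite (_ : 2 * (r - 1) / (r + 1) = 12 / 109); last by rewrite /r; field.
  by rewrite -mulr_natl; lra.
by rewrite ler_ln ?posrE ?exprn_gt0 ?(lt_le_trans ltr01 r1)//; lra.
Qed.

(** The same device, with a rational number r slightly above the fourth root
    of 17/7. *)
Lemma ln_17_7_le (R : realType) : ln (1 + 10 / 7 : R) <= 119 / 134.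
Proof.
pose r : R := 201 / 161.
have r1 : 1 <= r by rewrite /r; lra.
have r4 : 1 + 10 / 7 <= r ^+ 4 by rewrite /r; lra.
apply: (@le_trans _ _ (ln (r ^+ 4))).
  by rewrite ler_ln ?posrE ?exprn_gt0 ?(lt_le_trans ltr01 r1)//; lra.
rewrite lnXn ?(lt_le_trans ltr01 r1)//.
have := ln_le_pade r1.
rewrite (_ : (r - 1) * (r + 5) / (4 * r + 2) = 40 / 161 * (503 / 563));
  last by rewrite /r; field.
by rewrite -mulr_natl; lra.
Qed.

(** * The critical function and the profile *)

(** In the variable g = 2t / sqrt (4 - t^2) the quotient L(t) / t has a
    derivative of the sign of this function. *)
Definition crit (R : realType) (g : R) : R :=
  g * (4 + g ^+ 2) / (4 * (1 + g)) - ln (1 + g).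

Definition dcrit (R : realType) (g : R) : R :=
  g * (2 * g ^+ 2 + 3 * g - 4) / (4 * (1 + g) ^+ 2).

Lemma is_derive_crit (R : realType) (g : R) : 0 <= g ->
  is_derive g 1 (@crit R) (dcrit g).
Proof.
move=> g0.
have g1 : 0 < 1 + g by lra.
have g4 : 4 * (1 + g) != 0 by rewrite gt_eqF//; lra.
rewrite /crit; notypeclasses refine (is_derive_eq _ _); first by deriv.
by rewrite /dcrit /=; field; rewrite gt_eqF.
Qed.

Lemma crit_lt0E (R : realType) (g : R) : 0 <= g ->
  (crit g < 0) = (g * (4 + g ^+ 2) < 4 * (1 + g) * ln (1 + g)).
Proof.
by move=> g0; rewrite subr_lt0 ltr_pdivrMr 1?mulrC// ?[ln _ * _]mulrC//; lra.
Qed.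

Lemma crit_gt0E (R : realType) (g : R) : 0 <= g ->
  (0 < crit g) = (4 * (1 + g) * ln (1 + g) < g * (4 + g ^+ 2)).
Proof.
by move=> g0; rewrite subr_gt0 ltr_pdivlMr 1?mulrC// ?[ln _ * _]mulrC//; lra.
Qed.

(** The Pade bound gives log (1 + g) >= 2g / (g + 2), and
    2g / (g + 2) - g (4 + g^2) / (4 (1 + g)) has the sign of 4 - 2g - g^2. *)
Lemma crit_lt0 (R : realType) (g : R) : 0 < g <= 1 -> crit g < 0.
Proof.
move=> /andP[g0 g1]; rewrite crit_lt0E; last exact: ltW.
have : 2 * (1 + g - 1) / (1 + g + 1) <= ln (1 + g) by apply: ln_ge_pade; lra.
rewrite ler_pdivrMr; last by lra.
move=> h; rewrite -(@ltr_pM2r _ (1 + g + 1)); last by lra.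
apply: (@lt_le_trans _ _ (4 * (1 + g) * (2 * (1 + g - 1)))); last first.
  by rewrite -[leRHS]mulrA ler_pM2l//; lra.
rewrite -subr_gt0.
rewrite [ltRHS](_ : _ = g ^+ 2 * (4 - 2 * g - g ^+ 2)); last by ring.
by rewrite mulr_gt0 ?exprn_gt0//; nra.
Qed.

(** The factor 2 g^2 + 3 g - 4 of the derivative is positive from 1 on. *)
Lemma crit_incr (R : realType) (a b : R) : 1 <= a -> a < b -> crit a < crit b.
Proof.
move=> a1 ab; apply: (is_derive_gt0_lt (df := @dcrit R) ab) =>
  [x /andP[ax xb]|x /andP[ax xb]].
  by apply: is_derive_crit; lra.
rewrite /dcrit divr_gt0// ?mulr_gt0 ?exprn_gt0//; try lra.
by nra.
Qed.

Lemma crit_root (R : realType) :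
  exists2 g : R, 17 / 12 < g < 10 / 7 & crit g = 0.
Proof.
have lo : crit (17 / 12 : R) < 0.
  by have := ln_29_12_ge R; rewrite crit_lt0E; lra.
have hi : 0 < crit (10 / 7 : R).
  by have := ln_17_7_le R; rewrite crit_gt0E; lra.
have [||| g] := @IVT R (@crit R) (17 / 12) (10 / 7) 0.
- by lra.
- apply: derivable_within_continuous => y; rewrite in_itv/= => /andP[y1 _].
  by have [|] := @is_derive_crit R y; [lra|].
- by rewrite ge_min le_max (ltW lo) (ltW hi) orbT.
rewrite in_itv/= => /andP[g1 g2] g0; exists g => //.
rewrite !lt_neqAle g1 g2 !andbT; apply/andP; split; apply/eqP => gE.
  by rewrite gE g0 ltxx in lo.
by rewrite -gE g0 ltxx in hi.
Qed.

(** Four times the square of L(t) / t, in the variable g; squaring removes the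
    square root from 1 / t = sqrt (4 + g^2) / (2g). *)
Definition profile (R : realType) (g : R) : R :=
  ln (1 + g) ^+ 2 * (1 + 4 / g ^+ 2).

Definition dprofile (R : realType) (g : R) : R :=
  8 * ln (1 + g) * crit g / g ^+ 3.

Lemma is_derive_profile (R : realType) (g : R) : 0 < g ->
  is_derive g 1 (@profile R) (dprofile g).
Proof.
move=> g0.
have g1 : 0 < 1 + g by lra.
have g2 : g ^+ 2 != 0 by rewrite expf_neq0// gt_eqF.
rewrite /profile; notypeclasses refine (is_derive_eq _ _); first by deriv.
rewrite /dprofile /crit /=; field.
by rewrite !gt_eqF.
Qed.

(** The derivative of [profile] has the sign of [crit], hence is nonpositive
    before the zero g0 of [crit] and nonnegative after it. *)
Lemma profile_min (R : realType) (g0 g : R) : 1 < g0 -> crit g0 = 0 -> 0 < g ->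
  profile g0 <= profile g.
Proof.
move=> g01 g00 gp.
have [gg|gg] := leP g g0.
  rewrite -lerN2.
  apply: (is_derive_ge0_le gg (f := fun h => - profile h)
    (df := fun h => - dprofile h)) => [x /andP[gx xg]|x /andP[gx xg]].
    by apply: is_derive_opp; apply: is_derive_profile; lra.
  rewrite oppr_ge0 /dprofile pmulr_lle0 ?invr_gt0 ?exprn_gt0//; last by lra.
  rewrite pmulr_rle0 ?mulr_gt0// ?ln_gt0//; try lra.
  have [x1|x1] := leP x 1; first by rewrite ltW// crit_lt0// x1 (lt_trans gp).
  by rewrite -g00 ltW// crit_incr// ltW.
apply: (is_derive_ge0_le (df := @dprofile R) (ltW gg)) =>
  [x /andP[gx xg]|x /andP[gx xg]].
  by apply: is_derive_profile; lra.
rewrite /dprofile divr_ge0 ?exprn_ge0 ?mulr_ge0 ?ln_ge0//; try lra.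
by rewrite -g00 ltW// crit_incr// ltW.
Qed.

(** * The substitution g = 2t / sqrt (4 - t^2) *)

Lemma sqr_lt (R : realType) (a b : R) : 0 <= b -> a ^+ 2 < b ^+ 2 -> a < b.
Proof. by move=> b0 ab; rewrite ltNge; apply/negP => ba; nra. Qed.

Lemma sqr_le (R : realType) (a b : R) : 0 <= b -> a ^+ 2 <= b ^+ 2 -> a <= b.
Proof. by move=> b0 ab; rewrite leNgt; apply/negP => ba; nra. Qed.

Section Substitution.
Context {R : realType}.
Implicit Types t g : R.

(** With t = 2 sin a this is 2 tan a; [chord] is its inverse. *)
Definition ratio t : R := 2 * t / Num.sqrt (4 - t ^+ 2).
Definition chord g : R := 2 * g / Num.sqrt (4 + g ^+ 2).

Lemma ratio_den t : 0 < t < 2 ->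
  0 < Num.sqrt (4 - t ^+ 2) /\ Num.sqrt (4 - t ^+ 2) ^+ 2 = 4 - t ^+ 2.
Proof.
move=> t02; have h : 0 < 4 - t ^+ 2 by nra.
by rewrite sqrtr_gt0 sqr_sqrtr ?(ltW h).
Qed.

Lemma ratio_gt0 t : 0 < t < 2 -> 0 < ratio t.
Proof.
move=> t02; have [q0 _] := ratio_den t02.
by rewrite divr_gt0// mulr_gt0//; case/andP: t02.
Qed.

Lemma chord_sqr g : chord g ^+ 2 * (4 + g ^+ 2) = 4 * g ^+ 2.
Proof.
have q0 : 0 < 4 + g ^+ 2 by rewrite ltr_pwDl ?sqr_ge0.
rewrite /chord expr_div_n sqr_sqrtr ?ltW// divfK ?gt_eqF//; ring.
Qed.

Lemma chord_itv g : 0 < g -> 0 < chord g < 2.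
Proof.
move=> g0; have q0 : 0 < 4 + g ^+ 2 by rewrite ltr_pwDl ?sqr_ge0.
have c0 : 0 < chord g by rewrite divr_gt0 ?mulr_gt0 ?sqrtr_gt0.
rewrite c0/= -(@ltr_pXn2r _ 2) ?nnegrE ?ltW//.
by rewrite -(ltr_pM2r q0) chord_sqr; nra.
Qed.

Lemma chordK g : 0 < g -> ratio (chord g) = g.
Proof.
move=> g0; have c02 := chord_itv g0; have [q0 q2] := ratio_den c02.
apply/eqP; rewrite -(@eqrXn2 _ 2) ?ltW ?ratio_gt0//; apply/eqP.
rewrite /ratio expr_div_n q2.
have := chord_sqr g; set c := chord g => h.
have h4 : 4 - c ^+ 2 != 0 by rewrite -q2 expf_neq0// gt_eqF.
apply/eqP; rewrite -subr_eq0; apply/eqP.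
rewrite [LHS](_ : _ = (c ^+ 2 * (4 + g ^+ 2) - 4 * g ^+ 2) / (4 - c ^+ 2)).
  by rewrite h subrr mul0r.
by field.
Qed.

Lemma ratioK t : 0 < t < 2 -> chord (ratio t) = t.
Proof.
move=> t02; have [q0 q2] := ratio_den t02; have g0 := ratio_gt0 t02.
have [c0 _] := andP (chord_itv g0); have [t0 _] := andP t02.
apply/eqP; rewrite -(@eqrXn2 _ 2) ?ltW//; apply/eqP.
have h : 4 + ratio t ^+ 2 != 0 by rewrite gt_eqF// ltr_pwDl ?sqr_ge0.
apply: (mulIf h); rewrite chord_sqr /ratio expr_div_n q2; field.
by rewrite -q2 expf_neq0// gt_eqF.
Qed.

Lemma profile_ratio t : 0 < t < 2 ->
  profile (ratio t) = (2 * (t^-1 * ln (1 + ratio t))) ^+ 2.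
Proof.
move=> t02; have [q0 q2] := ratio_den t02; have [t0 _] := andP t02.
have tn : t != 0 by rewrite gt_eqF.
have qn : 4 - t ^+ 2 != 0 by rewrite -q2 expf_neq0// gt_eqF.
rewrite /profile; move: (ln _) => l.
by rewrite /ratio expr_div_n q2; field; rewrite tn qn.
Qed.

(** With q = sqrt (4 - t^2) one has 4 + g^2 = 16 / q^2 and 2t + q = q (1 + g),
    so the left-hand side of the critical equation is a nonzero multiple of
    [crit g]. *)
Lemma crit_ratio t : 0 < t < 2 ->
  (4 - t ^+ 2) * (2 * t + Num.sqrt (4 - t ^+ 2)) * ln (1 + ratio t) - 8 * t
  = - (Num.sqrt (4 - t ^+ 2) ^+ 3 * (1 + ratio t)) * crit (ratio t).
Proof.
move=> t02; have [q0 q2] := ratio_den t02; have [t0 _] := andP t02.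
rewrite /crit; move: (ln _) => l; rewrite /ratio.
set q := Num.sqrt _ in q0 q2 *.
have qn : q != 0 by rewrite gt_eqF.
have qt : q + 2 * t != 0 by rewrite gt_eqF// addr_gt0// mulr_gt0.
rewrite -q2 (_ : 4 + (2 * t / q) ^+ 2 = 16 / q ^+ 2).
  by field; rewrite qn qt.
by rewrite (_ : 16 = 4 * (q ^+ 2 + t ^+ 2)); [field|rewrite q2; ring].
Qed.

(** Uniqueness: a zero of [crit] cannot lie in (0, 1], where [crit] is negative,
    and [crit] is injective on [1, oo).  The bounds on t0 come from
    t0^2 = 4 g0^2 / (4 + g0^2) with 17/12 < g0 < 10/7; c is bounded below
    through L(t0) >= log (29/12), and above by the value of L(t) / t at the point t
    that corresponds to g = 10/7, since c is the minimum. *)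
Lemma minimal_slope :
  let L := fun t : R => ln (1 + 2 * t / Num.sqrt (4 - t ^+ 2)) in
  exists t0 : R,
    let c := t0^-1 * L t0 in
    [/\ unique (fun t : R => 0 < t < 2 /\
          (4 - t ^+ 2) * (2 * t + Num.sqrt (4 - t ^+ 2)) * L t - 8 * t = 0) t0,
        `|t0 - 116 / 100| < 1 / 200,
        `|c - 76 / 100| < 1 / 200
      & forall t, 0 < t < 2 -> c <= t^-1 * L t].
Proof.
have [g0 g0b g0r] := crit_root R.
have [g0p g01] : 0 < g0 /\ 1 < g0 by lra.
move=> L.
have LE t : L t = ln (1 + ratio t) by [].
have L0 t : 0 < t < 2 -> 0 < L t.
  by move=> t02; rewrite LE ln_gt0// ltrDl ratio_gt0.
have t02 := chord_itv g0p; have tK := chordK g0p; have tS := chord_sqr g0.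
exists (chord g0); set t0 := chord g0 in t02 tK tS *.
have t0p : 0 < t0 by case/andP: t02.
have min t : 0 < t < 2 -> t0^-1 * L t0 <= t^-1 * L t.
  move=> t2; rewrite -(@ler_pM2l _ 2)// -(@ler_pXn2r _ 2) ?nnegrE//.
  - by rewrite !LE -!profile_ratio// tK profile_min// ratio_gt0.
  - by rewrite ltW// !mulr_gt0 ?invr_gt0 ?L0.
  - by rewrite ltW// !mulr_gt0 ?invr_gt0 ?L0//; case/andP: t2.
have [lo hi] : 52 / 45 < t0 /\ t0 < 50 / 43.
  have u0 : 0 < 4 + g0 ^+ 2 by rewrite ltr_pwDl ?sqr_ge0.
  have u1 : (17 / 12) ^+ 2 < g0 ^+ 2 by rewrite ltr_pXn2r ?nnegrE//; lra.
  have u2 : g0 ^+ 2 < (10 / 7) ^+ 2 by rewrite ltr_pXn2r ?nnegrE//; lra.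
  split.
    by apply: sqr_lt; [lra|rewrite -(ltr_pM2r u0) tS; lra].
  by apply: sqr_lt; [lra|rewrite -(ltr_pM2r u0) tS; lra].
move=> c; split => //.
- split=> [|t [t2 /eqP]].
    by split=> //; rewrite LE crit_ratio// tK g0r mulr0.
  have [q0 _] := ratio_den t2; have r0 := ratio_gt0 t2.
  have p0 : 0 < Num.sqrt (4 - t ^+ 2) ^+ 3 * (1 + ratio t).
    by rewrite mulr_gt0 ?exprn_gt0// addr_gt0.
  rewrite LE crit_ratio// mulf_eq0 oppr_eq0 (gt_eqF p0)/= => /eqP rt.
  rewrite -(ratioK t2) /t0; congr chord.
  have [r1|r1] := leP (ratio t) 1.
    by have := @crit_lt0 _ (ratio t); rewrite r0 r1 rt ltxx => /(_ isT).
  have [/(crit_incr (ltW r1))|/(crit_incr (ltW g01))|//] := ltgtP (ratio t) g0;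
    by rewrite rt g0r ltxx.
- by rewrite ltr_distl; apply/andP; split; lra.
- have cE : c * t0 = L t0 by rewrite /c mulrAC mulVf ?mul1r// gt_eqF.
  rewrite ltr_distl; apply/andP; split.
    have l0 : 96 / 109 <= L t0.
      rewrite LE tK (le_trans (ln_29_12_ge R))// ler_ln ?posrE; lra.
    rewrite -(ltr_pM2r t0p) cE; nra.
  have g1p : 0 < 10 / 7 :> R by lra.
  have := min _ (chord_itv g1p).
  rewrite [L (chord _)]LE chordK// => /le_lt_trans; apply.
  have [s0 _] := andP (chord_itv g1p).
  have s1 : 36 / 31 <= chord (10 / 7).
    have := chord_sqr (10 / 7).
    by rewrite -(@ler_pXn2r _ 2) ?nnegrE ?(ltW s0)//; lra.
  rewrite ltr_pdivrMl//; have := ln_17_7_le R; nra.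
Qed.
End Substitution.

(** * Euclidean geometry of the unit ball *)

Section Euclidean.
Context {R : realType} {n : nat}.
Implicit Types (u v w x y p : 'rV[R]_n) (a : R).

Definition dot u v : R := \sum_(i < n) u 0 i * v 0 i.

Lemma dotC u v : dot u v = dot v u.
Proof. by apply: eq_bigr => i _; rewrite mulrC. Qed.

Lemma dotDl u v w : dot (u + v) w = dot u w + dot v w.
Proof. by rewrite -big_split; apply: eq_bigr => i _; rewrite mxE mulrDl. Qed.

Lemma dotZl a u v : dot (a *: u) v = a * dot u v.
Proof. by rewrite mulr_sumr; apply: eq_bigr => i _; rewrite mxE mulrA. Qed.

Lemma dotNl u v : dot (- u) v = - dot u v.
Proof. by rewrite -scaleN1r dotZl mulN1r. Qed.

Lemma dotDr u v w : dot u (v + w) = dot u v + dot u w.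
Proof. by rewrite ![dot u _]dotC dotDl. Qed.

Lemma dotZr a u v : dot u (a *: v) = a * dot u v.
Proof. by rewrite ![dot u _]dotC dotZl. Qed.

Lemma dotNr u v : dot u (- v) = - dot u v.
Proof. by rewrite ![dot u _]dotC dotNl. Qed.

Definition dotE := (dotDl, dotDr, dotNl, dotNr, dotZl, dotZr).

Lemma dot_ge0 u : 0 <= dot u u.
Proof. by apply: sumr_ge0 => i _; rewrite -expr2 sqr_ge0. Qed.

Lemma enormE u : enorm u = Num.sqrt (dot u u).
Proof. by congr Num.sqrt; apply: eq_bigr. Qed.

Lemma enorm_ge0 u : 0 <= enorm u. Proof. exact: sqrtr_ge0. Qed.

Lemma sqr_enorm u : enorm u ^+ 2 = dot u u.
Proof. by rewrite enormE sqr_sqrtr ?dot_ge0. Qed.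

Lemma enormZ a u : enorm (a *: u) = `|a| * enorm u.
Proof.
by rewrite !enormE !dotE mulrA -expr2 sqrtrM ?sqr_ge0// sqrtr_sqr.
Qed.

Lemma enormN u : enorm (- u) = enorm u.
Proof. by rewrite -scaleN1r enormZ normrN1 mul1r. Qed.

Lemma enorm_eq0 u : enorm u = 0 -> u = 0.
Proof.
move=> u0; have : dot u u = 0 by rewrite -sqr_enorm u0 expr0n.
move/psumr_eq0P => h; apply/rowP => i; rewrite mxE; apply/eqP.
by rewrite -sqrf_eq0 expr2 h// => j _; rewrite -expr2 sqr_ge0.
Qed.

Lemma enorm_eq1 u : (enorm u = 1) <-> (dot u u = 1).
Proof.
split=> [u1|u1]; first by rewrite -sqr_enorm u1 expr1n.
by rewrite enormE u1 sqrtr1.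
Qed.

Lemma enorm_e1 : (0 < n)%N -> enorm (e1 R n) = 1.
Proof.
move=> n0; apply/enorm_eq1; rewrite /dot (bigD1 (Ordinal n0))//= big1.
  by rewrite !mxE mulr1 addr0.
by move=> i; rewrite !mxE -val_eqE/= => /negPf ->; rewrite mulr0.
Qed.

(** The case of the Cauchy-Schwarz inequality with one unit vector: the
    left-hand side is the squared length of the projection of u on p. *)
Lemma dot_unit_le u p : enorm p = 1 -> dot u p ^+ 2 <= enorm u ^+ 2.
Proof.
move/enorm_eq1 => p1; rewrite sqr_enorm -subr_ge0.
have := dot_ge0 (u - dot u p *: p); rewrite !dotE p1 (dotC p u).
by congr (0 <= _); ring.
Qed.

(** The zero vector is covered too, with any unit vector as direction: pairs
    x, y then need no separate treatment when x = y. *)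
Lemma unit_direction v : (0 < n)%N ->
  exists2 u, enorm u = 1 & v = enorm v *: u.
Proof.
move=> n0; have [v0|v0] := eqVneq (enorm v) 0.
  by exists (e1 R n); rewrite ?enorm_e1// v0 scale0r; exact: enorm_eq0.
exists ((enorm v)^-1 *: v); last by rewrite scalerA divff ?scale1r.
by rewrite enormZ ger0_norm ?invr_ge0 ?enorm_ge0// mulVf.
Qed.

Lemma sphere_dist x p : enorm x < 1 -> enorm p = 1 ->
  1 - enorm x <= enorm (x - p).
Proof.
move=> x1 p1; have h := dot_unit_le x p1; have x0 := enorm_ge0 x.
apply: sqr_le; first exact: enorm_ge0.
have : dot x p <= enorm x by exact: sqr_le.
rewrite sqr_enorm !dotE -!sqr_enorm p1 (dotC p x) => {}h.
by nra.
Qed.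

(** The point p is the end, nearer to the midpoint m, of the chord of the ball
    that carries x and y.  It is p = m + tau u, where u is the direction of the
    line, oriented so that b = m.u >= 0, and tau is the nonnegative root of
    tau^2 + 2 b tau = 1 - |m|^2.  With x = m + s u and y = m - s u the product
    of the distances is |s - tau||s + tau|, and tau lies between |s| (as x and y are in
    the ball) and 1. *)
Lemma near_endpoint x y : (0 < n)%N -> enorm x < 1 -> enorm y < 1 ->
  exists2 p, enorm p = 1 &
    enorm (x - p) * enorm (p - y) <= 1 - (enorm (x - y) / 2) ^+ 2.
Proof.
move=> n0 x1 y1.
(* m is kept opaque, so that the bilinearity rules do not expand it *)
have [m mE] : exists m, m = 2^-1 *: (x + y) by exists (2^-1 *: (x + y)).
(* s may be negative: its sign absorbs the orientation of u *)
have [u [s [u1 b0 xyE ->]]] : exists u, exists s, [/\ enorm u = 1,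
    0 <= dot m u, x - y = (2 * s) *: u & (enorm (x - y) / 2) ^+ 2 = s ^+ 2].
  have [v v1 xyE] := unit_direction (x - y) n0.
  have dE : 2 * (enorm (x - y) / 2) = enorm (x - y) by field.
  have [mv|/ltW mv] := leP 0 (dot m v).
    by exists v, (enorm (x - y) / 2); rewrite dE.
  exists (- v), (- (enorm (x - y) / 2)).
  by rewrite enormN dotNr oppr_ge0 mulrN dE scaleNr scalerN opprK sqrrN.
have xE : x = m + s *: u.
  by apply/rowP => i; move/rowP/(_ i): xyE; rewrite mE !mxE; lra.
have yE : y = m - s *: u.
  by apply/rowP => i; move/rowP/(_ i): xyE; rewrite mE !mxE; lra.
have uu : dot u u = 1 by apply/enorm_eq1.
have chord1 : dot m m + 2 * `|s| * dot m u + `|s| ^+ 2 < 1.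
  have : enorm x ^+ 2 < 1 by rewrite expr_lt1// enorm_ge0.
  have : enorm y ^+ 2 < 1 by rewrite expr_lt1// enorm_ge0.
  rewrite !sqr_enorm xE yE !dotE uu (dotC u m).
  by case: (ger0P s) => _; lra.
have m0 := dot_ge0 m; have s0 := normr_ge0 s.
set b := dot m u in b0 chord1; set M := dot m m in m0 chord1.
pose r := Num.sqrt (b ^+ 2 + 1 - M).
have r2 : r ^+ 2 = b ^+ 2 + 1 - M.
  by rewrite sqr_sqrtr//; have := sqr_ge0 b; nra.
have sr : `|s| <= r - b.
  rewrite lerBrDr -(@ler_pXn2r _ 2) ?nnegrE ?addr_ge0 ?sqrtr_ge0// r2; nra.
exists (m + (r - b) *: u).
  by apply/enorm_eq1; rewrite !dotE uu (dotC u m) -/b -/M; lra.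
have -> : x - (m + (r - b) *: u) = (s - (r - b)) *: u.
  by rewrite {1}xE; apply/rowP => i; rewrite !mxE; ring.
have -> : m + (r - b) *: u - y = (r - b + s) *: u.
  by rewrite {1}yE; apply/rowP => i; rewrite !mxE; ring.
rewrite !enormZ u1 !mulr1 -normrM.
rewrite (_ : _ * _ = s ^+ 2 - (r - b) ^+ 2); last by ring.
rewrite ler0_norm; last first.
  by rewrite subr_le0 -real_normK ?num_real// ler_pXn2r ?nnegrE// (le_trans s0).
by rewrite opprB lerD2r; nra.
Qed.
End Euclidean.

(** * The boundary of the unit ball *)

Section Boundary.
Context {R : realType} {n : nat}.
Implicit Types (p : 'rV[R]_n).

Lemma enorm_continuous : continuous (@enorm R n).
Proof.
have c : continuous (fun x : 'rV[R]_n => \sum_(i < n) x 0 i ^+ 2).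
  apply: continuous_big => [|i _ x]; first exact: add_continuous.
  by apply: continuousM; exact: coord_continuous.
by move=> x; apply: continuous_comp; [exact: c|exact: sqrt_continuous].
Qed.

Lemma open_unit_ball : open (@unit_ball R n).
Proof.
apply: (@open_comp _ _ (@enorm R n) [set x | x < 1]).
  by move=> ? _; exact: enorm_continuous.
exact: open_lt.
Qed.

(** A unit vector p is the limit of the vectors t p of the ball as t tends to 1
    from below. *)
Lemma boundary_unit_ball : boundary (@unit_ball R n) = [set p | enorm p = 1].
Proof.
apply/seteqP; split=> p; rewrite /boundary/=.
  case; rewrite (iffLR (interior_id _) open_unit_ball) => pc pb.
  apply/eqP; rewrite eq_le; apply/andP; split; last first.
    by rewrite leNgt; apply/negP.
  have cl : closed [set x : 'rV[R]_n | enorm x <= 1].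
    apply: (@closed_comp _ _ (@enorm R n) [set x | x <= 1]).
      by move=> ? _; exact: enorm_continuous.
    exact: closed_le.
  by apply: cl; apply: closure_subset pc => z; rewrite /unit_ball/= => /ltW.
move=> p1; split; last by move/interior_subset; rewrite /unit_ball/= p1 ltxx.
move=> A pA.
have : \forall t \near (1 : R)^'-, A (t *: p).
  have : t *: p @[t --> (1 : R)^'-] --> 1 *: p.
    apply: cvg_at_left_filter; exact: scalel_continuous.
  by rewrite scale1r => /(_ A pA).
move=> pA1; near (1 : R)^'- => t; exists (t *: p); split; last by near: t.
rewrite /unit_ball/= enormZ p1 mulr1 ger0_norm.
  by near: t; exact: nbhs_left_lt.
by near: t; exact: nbhs_left_ge.
Unshelve. all: by end_near. Qed.
End Boundary.

(** * The metric on the unit ball *)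

Section Cassinian.
Context {R : realType} {n : nat}.
Implicit Types (x y p : 'rV[R]_n).

Lemma sqrt_chord (d : R) : 2 * d / Num.sqrt (4 - d ^+ 2)
  = d / Num.sqrt (1 - (d / 2) ^+ 2).
Proof.
rewrite (_ : 4 - d ^+ 2 = 2 ^+ 2 * (1 - (d / 2) ^+ 2)); last by field.
rewrite sqrtrM ?sqr_ge0// sqrtr_sqr ger0_norm//.
by rewrite invfM mulrACA divff ?mul1r.
Qed.

(** By the parallelogram law. *)
Lemma dist_lt2 x y : enorm x < 1 -> enorm y < 1 -> enorm (x - y) < 2.
Proof.
move=> x1 y1.
have x2 : enorm x ^+ 2 < 1 by rewrite expr_lt1// enorm_ge0.
have y2 : enorm y ^+ 2 < 1 by rewrite expr_lt1// enorm_ge0.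
rewrite ltNge; apply/negP => d2.
have {}d2 : 2 ^+ 2 <= enorm (x - y) ^+ 2.
  by rewrite ler_pXn2r ?nnegrE ?enorm_ge0.
have s0 := dot_ge0 (x + y).
rewrite !sqr_enorm !dotE (dotC y x) in x2 y2 d2 s0.
lra.
Qed.

(** The value at the point of [near_endpoint] is at most the supremum because
    the set is bounded: its elements are at most
    |x - y| / sqrt ((1 - |x|) (1 - |y|)). *)
Lemma sup_ge x y : (0 < n)%N -> enorm x < 1 -> enorm y < 1 ->
  enorm (x - y) / Num.sqrt (1 - (enorm (x - y) / 2) ^+ 2) <=
  sup [set enorm (x - y) / Num.sqrt (enorm (x - p) * enorm (p - y))
    | p in boundary (@unit_ball R n)].
Proof.
move=> n0 x1 y1; rewrite boundary_unit_ball.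
have d0 := enorm_ge0 (x - y).
have far p : enorm p = 1 ->
    (1 - enorm x) * (1 - enorm y) <= enorm (x - p) * enorm (p - y).
  move=> p1; rewrite -[p - y]opprB enormN.
  by rewrite ler_pM ?subr_ge0 ?(ltW x1) ?(ltW y1) ?sphere_dist.
have pos : 0 < (1 - enorm x) * (1 - enorm y) by rewrite mulr_gt0 ?subr_gt0.
have [p p1 ple] := near_endpoint n0 x1 y1.
have pp := lt_le_trans pos (far p p1).
apply: (@le_trans _ _
  (enorm (x - y) / Num.sqrt (enorm (x - p) * enorm (p - y)))).
  rewrite ler_wpM2l// lef_pV2 ?posrE ?sqrtr_gt0 ?ler_wsqrtr//.
  exact: lt_le_trans pp ple.
apply: ub_le_sup; last by exists p.
exists (enorm (x - y) / Num.sqrt ((1 - enorm x) * (1 - enorm y))).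
move=> _ [q q1 <-].
rewrite ler_wpM2l// lef_pV2 ?posrE ?sqrtr_gt0 ?ler_wsqrtr ?far//.
exact: lt_le_trans pos (far q q1).
Qed.

Lemma cassinian_ge x y : (0 < n)%N -> enorm x < 1 -> enorm y < 1 ->
  ln (1 + 2 * enorm (x - y) / Num.sqrt (4 - enorm (x - y) ^+ 2)) <=
  cassinian (@unit_ball R n) x y.
Proof.
move=> n0 x1 y1; have := sup_ge n0 x1 y1; rewrite -sqrt_chord => le.
have pos : 0 < 1 + 2 * enorm (x - y) / Num.sqrt (4 - enorm (x - y) ^+ 2).
  by rewrite ltr_pwDl// divr_ge0 ?sqrtr_ge0 ?mulr_ge0 ?enorm_ge0.
by rewrite ler_ln ?posrE ?lerD2l// (lt_le_trans pos)// lerD2l.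
Qed.

(** Antipodal pairs attain the lower bound of [cassinian_ge]: for |p| = 1,
    (|x - p||p + x|)^2 = (1 + |x|^2)^2 - 4 (x.p)^2 >= (1 - |x|^2)^2. *)
Lemma cassinian_opp x : (0 < n)%N -> enorm x < 1 ->
  cassinian (@unit_ball R n) x (- x) =
  ln (1 + 2 * enorm (x - - x) / Num.sqrt (4 - enorm (x - - x) ^+ 2)).
Proof.
move=> n0 x1; have nx1 : enorm (- x) < 1 by rewrite enormN.
congr (ln (1 + _)); apply/eqP; rewrite eq_le sqrt_chord sup_ge// andbT.
have xx : x - - x = 2 *: x by rewrite opprK scaler_nat mulr2n.
have dE : enorm (x - - x) / 2 = enorm x.
  by rewrite xx enormZ ger0_norm// mulrAC divff ?mul1r.
have x0 := enorm_ge0 x.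
have pos : 0 < 1 - enorm x ^+ 2 by rewrite subr_gt0 expr_lt1.
apply: ge_sup.
  rewrite boundary_unit_ball; apply: image_nonempty.
  by exists (e1 R n); exact: enorm_e1.
rewrite boundary_unit_ball => _ [p p1 <-]; rewrite dE.
have le : 1 - enorm x ^+ 2 <= enorm (x - p) * enorm (p - - x).
  apply: sqr_le; first by rewrite mulr_ge0 ?enorm_ge0.
  have := dot_unit_le x p1; rewrite exprMn !sqr_enorm opprK !dotE.
  by rewrite -!sqr_enorm p1 (dotC p x); nra.
rewrite ler_wpM2l ?enorm_ge0// lef_pV2 ?posrE ?sqrtr_gt0 ?ler_wsqrtr//.
exact: lt_le_trans pos le.
Qed.
End Cassinian.

Theorem theorem3p2 (R : realType) :
  let L := fun t : R => ln (1 + 2 * t / Num.sqrt (4 - t ^+ 2)) in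
  exists t0 : R,
    let c := t0^-1 * L t0 in
    [/\ unique (fun t : R => 0 < t < 2 /\
          (4 - t ^+ 2) * (2 * t + Num.sqrt (4 - t ^+ 2)) * L t - 8 * t = 0) t0,
        `|t0 - 116 / 100| < 1 / 200,
        `|c - 76 / 100| < 1 / 200,
        (let V := [set t^-1 * L t | t in [set t : R | 0 < t < 2]] in
         V c /\ lbound V c)
      & forall (n : nat) (x y : 'rV[R]_n),
          (0 < n)%N -> unit_ball x -> unit_ball y ->
          let w := (enorm (x - y) / 2) *: e1 R n in
          [/\ cassinian (@unit_ball R n) x y
                >= cassinian (@unit_ball R n) (- w) w,
              cassinian (@unit_ball R n) (- w) w
                = ln (1 + 2 * enorm (x - y) / Num.sqrt (4 - enorm (x - y) ^+ 2)),
              ln (1 + 2 * enorm (x - y) / Num.sqrt (4 - enorm (x - y) ^+ 2))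
                >= c * enorm (x - y)
            & y = - x ->
              cassinian (@unit_ball R n) x y
                = cassinian (@unit_ball R n) (- w) w]].
Proof.
have [t0 [t0u t0b cb cmin]] := @minimal_slope R.
move=> L; exists t0; move=> c; split; [exact: t0u|exact: t0b|exact: cb| |].
  split; first by exists t0 => //; case: t0u => -[].
  by move=> _ [t t02 <-]; exact: cmin.
move=> n x y n0 x1 y1 w.
have d0 := enorm_ge0 (x - y); have d2 := dist_lt2 x1 y1.
have wd : enorm (- w) = enorm (x - y) / 2.
  by rewrite enormN enormZ enorm_e1// mulr1 ger0_norm// divr_ge0.
have wwd : enorm (- w - w) = enorm (x - y).
  rewrite -opprD -mulr2n -scaler_nat enormN enormZ -[enorm w]enormN wd.
  by rewrite ger0_norm// mulrC divfK.
have wE : cassinian (@unit_ball R n) (- w) w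
    = ln (1 + 2 * enorm (x - y) / Num.sqrt (4 - enorm (x - y) ^+ 2)).
  rewrite -{2}[w]opprK cassinian_opp//; first by rewrite opprK wwd.
  by rewrite wd ltr_pdivrMr// mul1r.
rewrite wE; split; [exact: cassinian_ge|exact: erefl| |].
  have [->|dn0] := eqVneq (enorm (x - y)) 0.
    by rewrite !mulr0 mul0r addr0 ln1.
  have dp : 0 < enorm (x - y) by rewrite lt0r dn0.
  by rewrite -ler_pdivlMr// mulrC; apply: cmin; rewrite dp.
by move=> yE; rewrite {1}yE cassinian_opp// -yE.
Qed.
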